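(* Let $p>1$ and $q$ be such that $\frac1p+\frac1q=1$, and let $\mathcal{B}=(B_1,\dots,B_m)$ be an $m$-tuple of real symmetric $n\times n$ matrices such that $m\ge n$, each $B_i$ is nonzero and positive semidefinite, each $B_i$ has rank at most $r$ (where $1\le r\le n$), and $\sum_{i=1}^mB_i$ has full rank. Then there exists a unique vector $\tau^*\in\mathbb{R}^m_{++}$ such that $$\frac{\ell_i(\tau^*;\mathcal{B})^{1/q}}{\tau_i^*}=n^{1/q},\qquad i=1,\dots,m.$$ This vector satisfies $\|\tau^*\|_q=1$, and it is the unique solution of the minimization problem $$\min_{\tau\in\mathbb{R}^m}\ V(\tau)=-\ln\det B(\tau)+\frac nq\|\tau\|_q^q .$$
   Context: $\mathbb{R}^m_{++}$ is the set of vectors with strictly positive entries; $B(\tau)=\sum_{i=1}^m\tau_iB_i$; for $\tau\in\mathbb{R}^m_{++}$ (for which $B(\tau)$ is positive definite), $\ell_i(\tau;\mathcal{B})=\mathrm{Tr}\left[\tau_iB(\tau)^{-1}B_i\right]$; $\|\tau\|_q=(\sum_i|\tau_i|^q)^{1/q}$. The function $V$ is considered on its domain $\{\tau\in\mathbb{R}^m:B(\tau)\succ0\}$, i.e. $V(\tau)=+\infty$ when $B(\tau)$ is not positive definite. *)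

(* Defs.v *)
From mathcomp Require Export all_boot all_order all_algebra.
From mathcomp Require Export all_classical all_reals all_analysis.

Set Implicit Arguments.
Unset Strict Implicit.
Unset Printing Implicit Defensive.

Export Order.TTheory GRing.Theory Num.Theory.

Local Open Scope ring_scope.

(* The two predicates below only constrain the quadratic form u |-> u A u^T;
   they are used on symmetric matrices, symmetry being a separate hypothesis. *)
Definition semiposdefmx (R : realType) (n : nat) (A : 'M[R]_n) : Prop :=
  forall u : 'rV[R]_n, 0 <= (u *m A *m u^T) 0 0.

Definition posdefmx (R : realType) (n : nat) (A : 'M[R]_n) : Prop :=
  forall u : 'rV[R]_n, u != 0 -> 0 < (u *m A *m u^T) 0 0.

Definition positive_row (R : realType) (m : nat) (tau : 'rV[R]_m) : Prop :=
  forall i, 0 < tau 0 i.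

Definition lincombmx (R : realType) (m n : nat) (B : 'I_m -> 'M[R]_n)
    (tau : 'rV[R]_m) : 'M[R]_n :=
  \sum_(i < m) tau 0 i *: B i.

Definition leverage (R : realType) (m n : nat) (B : 'I_m -> 'M[R]_n)
    (tau : 'rV[R]_m) (i : 'I_m) : R :=
  \tr (tau 0 i *: (invmx (lincombmx B tau) *m B i)).

Definition row_pnorm (R : realType) (m : nat) (q : R) (tau : 'rV[R]_m) : R :=
  (\sum_(i < m) `|tau 0 i| `^ q) `^ q^-1.

Definition potential (R : realType) (m n : nat) (q : R) (B : 'I_m -> 'M[R]_n)
    (tau : 'rV[R]_m) : \bar R :=
  if `[< posdefmx (lincombmx B tau) >] then
    (- ln (\det (lincombmx B tau)) + n%:R / q * row_pnorm q tau `^ q)%:E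
  else +oo%E.

Definition minimizer (R : realType) (T : Type) (f : T -> \bar R) (x : T) : Prop :=
  forall y, (f x <= f y)%E.

(* Main.v *)
Require Import Defs.
From mathcomp Require Import ring lra.
Import numFieldNormedType.Exports.

(* Given [lincombmx B tau] positive definite, the equations say that
   [\tr (B(tau)^-1 B_i) = n tau_i^(q-1)], i.e. that [tau] is a critical point of
   the potential [V]. Concavity of [ln \det] and strict convexity of [|x|^q]
   make any positive critical point the unique global minimizer of [V], which
   gives both uniqueness claims; summing [tau_i] times the equations gives
   [\sum_i tau_i^q = 1].

   For existence, maximize [\det B(t)] over the compact convex set
   [t >= 0, \sum_i t_i^q <= 1]. With [g_i = \tr (B(t)^-1 B_i) > 0] at a
   maximizer [t], the first-order condition is
   [\sum_i g_i s_i <= n = \sum_i g_i t_i] for all [s] in this set. The left-hand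
   side has a unique maximizer, with [s_i] proportional to [g_i^(1/(q-1))], so
   [t = s] and [t] is critical. *)

Set Implicit Arguments.
Unset Strict Implicit.
Unset Printing Implicit Defensive.

Local Open Scope ring_scope.
Local Open Scope classical_set_scope.

(** * Positive definite and semidefinite matrices *)

Lemma symmetricmx_tr (R : realType) n (A : 'M[R]_n) :
  A \is symmetricmx -> A^T = A.
Proof.
by move=> /is_hermitianmxP; rewrite expr0 scale1r map_mx_id.
Qed.

(** Induction on the size: split off the first row and column. The Schur complement [S] of the
    corner entry [a] is again positive definite, and its factor [L'] is completed by a first column
    made of [s = sqrt a] and [s^-1 *: b^T]. *)
Lemma cholesky (R : realType) n (A : 'M[R]_n) :
  A^T = A -> posdefmx A ->
  exists L : 'M[R]_n, [/\ is_trig_mx L, A = L *m L^T & forall i, 0 < L i i].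
Proof.
elim: n A => [|n IHn] A symA posA.
  exists 0; split; [exact: mx0_is_trig| |by case].
  by apply/matrixP => -[].
pose A' : 'M[R]_(1 + n) := A.
pose a := A 0 0; pose b : 'rV[R]_n := ursubmx A'.
pose D : 'M[R]_n := drsubmx A'.
have defA : A = block_mx a%:M b b^T D :> 'M[R]_(1 + n).
  rewrite -[LHS](@submxK _ 1 n 1 n) trmx_ursub symA; congr block_mx.
  apply/matrixP => i j; rewrite !ord1 !mxE /= mulr1n /a.
  by congr (A _ _); apply/val_inj.
have symD : D^T = D by rewrite trmx_drsub symA.
have quadA (x : 'M[R]_1) (v : 'rV[R]_n) :
    row_mx x v *m A *m (row_mx x v)^T =
    x *m a%:M *m x + x *m b *m v^T + (v *m b^T *m x + v *m D *m v^T).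
  rewrite defA (@mul_row_block _ 1 1 n 1 n) tr_row_mx (@mul_row_col _ 1 1 n 1).
  have -> : x^T = x by apply/matrixP => i j; rewrite mxE !ord1.
  by rewrite !mulmxDl addrACA.
have a_gt0 : 0 < a.
  have nz : row_mx (1%:M : 'M[R]_1) (0 : 'rV[R]_n) != 0.
    apply/eqP => /(congr1 (@lsubmx R 1 1 n)); rewrite row_mxKl linear0.
    by move/matrixP/(_ 0 0); rewrite !mxE => /eqP; rewrite oner_eq0.
  have := posA _ nz; rewrite quadA mul0mx !mulmx1 mul1mx linear0 mulmx0 !mul0mx.
  by rewrite !addr0 mxE mulr1n.
pose S := D - a^-1 *: (b^T *m b).
have symS : S^T = S.
  by rewrite /S linearB linearZ /= trmx_mul trmxK symD.
have posS : posdefmx S.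
  move=> v v0; pose y := (b *m v^T) 0 0.
  have bv : b *m v^T = y%:M by rewrite [LHS]mx11_scalar.
  have vb : v *m b^T = y%:M.
    by rewrite -[LHS]trmxK trmx_mul trmxK bv tr_scalar_mx.
  (* Completing the square: the first coordinate [- (y / a)] minimizes the form of [A] among vectors
     with tail [v], and the minimum is the form of [S] at [v]. *)
  have nz : row_mx (- (y / a))%:M v != 0.
    apply: contra v0 => /eqP/(congr1 (@rsubmx R 1 1 n)).
    by rewrite row_mxKr linear0 => ->.
  have := posA _ nz; rewrite quadA /S mulmxBr mulmxBl vb.
  rewrite -(mulmxA _ b) bv -scalemxAr -scalemxAl mulmxA vb -(mulmxA _ b) bv.
  rewrite -!scalar_mxM !mxE !mulr1n.
  set z := \sum_(_ < _) _; suff -> : - (y / a) * a * - (y / a) + - (y / a) * y +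
     (y * - (y / a) + z) = z - a^-1 * (y * y) by [].
  by field; rewrite gt_eqF.
have [L' [trL' defS posL']] := IHn S symS posS.
pose s := Num.sqrt a.
have s_gt0 : 0 < s by rewrite sqrtr_gt0.
have ss : s * s = a by rewrite -expr2 sqr_sqrtr ?ltW.
exists (block_mx s%:M 0 (s^-1 *: b^T) L'); split.
- apply/is_trig_mxP => i j.
  have [i1 ->|i1 ->] := @split_ordP 1 n i;
    have [j1 ->|j1 ->] := @split_ordP 1 n j.
  + by rewrite !ord1.
  + by rewrite (@block_mxEur _ 1 n 1 n) mxE.
  + by rewrite !ord1.
  + rewrite (@block_mxEdr _ 1 n 1 n) => lt_ij.
    exact: (elimT is_trig_mxP trL' _ _ lt_ij).
- rewrite defA (@tr_block_mx _ 1 n 1 n) (@mulmx_block _ 1 n 1 n 1 n) -defS.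
  rewrite trmx0 !mulmx0 !mul0mx !addr0 tr_scalar_mx -scalar_mxM ss.
  rewrite linearZ /= trmxK mul_scalar_mx scalerA mulfV ?gt_eqF // scale1r.
  rewrite mul_mx_scalar scalerA mulfV ?gt_eqF // scale1r.
  rewrite -scalemxAr -scalemxAl scalerA -invfM ss /S.
  by rewrite addrC subrK.
- move=> i; have [i1 ->|i1 ->] := @split_ordP 1 n i.
  + by rewrite (@block_mxEul _ 1 n 1 n) !ord1 mxE mulr1n.
  + by rewrite (@block_mxEdr _ 1 n 1 n).
Qed.

Lemma trig_posdiag_unit (R : realType) n (L : 'M[R]_n) :
  is_trig_mx L -> (forall i, 0 < L i i) -> L \in unitmx.
Proof.
move=> trL posL; rewrite unitmxE unitfE det_trig // gt_eqF //.
by apply: prodr_gt0 => i _.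
Qed.

Lemma posdefmx_det_gt0 (R : realType) n (A : 'M[R]_n) :
  A^T = A -> posdefmx A -> 0 < \det A.
Proof.
move=> symA /(cholesky symA)[L [trL -> posL]].
rewrite det_mulmx det_tr -expr2 exprn_gt0 // det_trig //.
by apply: prodr_gt0 => i _.
Qed.

Lemma posdefmx_unit (R : realType) n (A : 'M[R]_n) :
  A^T = A -> posdefmx A -> A \in unitmx.
Proof. by move=> sA pA; rewrite unitmxE unitfE gt_eqF // posdefmx_det_gt0. Qed.

(** With [A = L L^T], the determinant is the product of the squared diagonal entries of [L], and
    each factor satisfies [L i i ^+ 2 <= A i i <= expR (A i i - 1)]. *)
Lemma posdefmx_det_le_expR (R : realType) n (A : 'M[R]_n) :
  A^T = A -> posdefmx A -> \det A <= expR (\tr A - n%:R).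
Proof.
move=> symA /(cholesky symA)[L [trL -> posL]].
rewrite det_mulmx det_tr det_trig // -big_split /=.
have -> : \tr (L *m L^T) - n%:R = \sum_i ((L *m L^T) i i - 1).
  by rewrite big_split /= sumrN sumr_const card_ord.
rewrite expR_sum; apply: ler_prod => i _; rewrite mulr_ge0 ?(ltW (posL i)) //=.
apply: le_trans (expR_ge1Dx _); rewrite addrC subrK.
rewrite mxE (bigD1 i) //= mxE lerDl sumr_ge0 // => j _.
by rewrite mxE -expr2 sqr_ge0.
Qed.

Lemma congrmx_posdef (R : realType) n (A M : 'M[R]_n) :
  M \in unitmx -> posdefmx A -> posdefmx (M *m A *m M^T).
Proof.
move=> unitM posA u u0; have := posA (u *m M).
rewrite trmx_mul !mulmxA; apply.
by apply: contra u0 => /eqP uM; rewrite -(mulmxK unitM u) uM mul0mx.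
Qed.

(* Concavity of [ln \det] as the tangent-plane bound at [A]. Writing
   [A = L L^T], it reduces to [\det X <= exp (\tr X - n)] for
   [X = L^-1 C L^-T]. *)
Lemma det_le_tangent (R : realType) n (A C : 'M[R]_n) :
  A^T = A -> posdefmx A -> C^T = C -> posdefmx C ->
  \det C <= \det A * expR (\tr (invmx A *m C) - n%:R).
Proof.
move=> symA /(cholesky symA)[L [trL -> posL]] symC posC.
have unitL := trig_posdiag_unit trL posL.
have unitLT : L^T \in unitmx by rewrite unitmx_tr.
have := @posdefmx_det_le_expR _ _ (invmx L *m C *m (invmx L)^T).
rewrite !trmx_mul trmxK symC mulmxA => /(_ erefl).
have /[swap]/[apply] : posdefmx (invmx L *m C *m (invmx L)^T).
  by apply: congrmx_posdef => //; rewrite unitmx_inv.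
have -> : invmx (L *m L^T) = (invmx L)^T *m invmx L.
  rewrite trmx_inv; apply: (can_inj (mulmxK (_ : L *m L^T \in unitmx))).
    by rewrite unitmx_mul unitL.
  rewrite mulVmx ?unitmx_mul ?unitL // -mulmxA (mulmxA (invmx L)) mulVmx //.
  by rewrite mul1mx mulVmx.
rewrite -(mulmxA _ (invmx L) C) [\tr ((invmx L)^T *m _)]mxtrace_mulC.
rewrite !det_mulmx !det_tr det_inv => le1.
have d_gt0 : 0 < \det L by rewrite det_trig // prodr_gt0.
have -> : \det C = \det L * \det L * ((\det L)^-1 * \det C * (\det L)^-1).
  by field; rewrite gt_eqF.
by rewrite ler_pM2l ?mulr_gt0.
Qed.

Lemma mulmx_trE (R : realType) n (v : 'rV[R]_n) :
  (v *m v^T) 0 0 = \sum_i v 0 i ^+ 2.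
Proof. by rewrite mxE; apply: eq_bigr => i _; rewrite mxE expr2. Qed.

(* Perturbing [u] in the direction [u A] makes the form negative unless
   [u A = 0]. *)
Lemma semiposdefmx_ker (R : realType) n (A : 'M[R]_n) (u : 'rV[R]_n) :
  A^T = A -> semiposdefmx A -> (u *m A *m u^T) 0 0 <= 0 -> u *m A = 0.
Proof.
move=> symA psdA; set s := (X in X <= 0) => s_le0; pose v := u *m A.
pose b := (v *m v^T) 0 0; pose c := (v *m A *m v^T) 0 0.
have bE : b = \sum_i v 0 i ^+ 2 by exact: mulmx_trE.
have b_ge0 : 0 <= b by rewrite bE sumr_ge0 // => i _; rewrite sqr_ge0.
have c_ge0 : 0 <= c by exact: psdA.
have quad t : 0 <= t * b *+ 2 + t ^+ 2 * c.
  have vAu : v *m A *m u^T = v *m v^T by rewrite [v^T]trmx_mul symA !mulmxA.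
  have := psdA (u + t *: v); rewrite linearD linearZ /=.
  rewrite !mulmxDl !mulmxDr -!scalemxAl -!scalemxAr -/v vAu.
  have -> (x y z w : 'M[R]_1) : (x + t *: y + (t *: z + t *: (t *: w))) 0 0 =
      x 0 0 + t * y 0 0 + (t * z 0 0 + t * (t * w 0 0)) by rewrite !mxE.
  rewrite -/b -/c -/s; move: s_le0; lra.
have b0 : b = 0.
  apply/eqP; rewrite eq_le b_ge0 andbT leNgt; apply/negP => b_gt0.
  have c1_gt0 : 0 < c + 1 by rewrite ltr_wpDl.
  (* Dividing by [c + 1] instead of [c] also covers [c = 0]; the value is then negative as soon as
     [b > 0]. *)
  have := quad (- (b / (c + 1))).
  have -> : - (b / (c + 1)) * b *+ 2 + (- (b / (c + 1))) ^+ 2 * c =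
    - ((b / (c + 1)) ^+ 2 * (c + 2)) by field; rewrite gt_eqF.
  rewrite oppr_ge0 leNgt mulr_gt0 ?exprn_gt0 ?divr_gt0 //; lra.
apply/rowP => j; rewrite [RHS]mxE; apply/eqP; rewrite -sqrf_eq0 -/v.
move/eqP: b0; rewrite bE psumr_eq0 => [/allP/(_ j)|i _]; last exact: sqr_ge0.
by rewrite mem_index_enum; exact.
Qed.

Lemma semiposdefmx_unit_posdef (R : realType) n (A : 'M[R]_n) :
  A^T = A -> semiposdefmx A -> A \in unitmx -> posdefmx A.
Proof.
move=> symA psdA unitA u u0; rewrite ltNge; apply: contra u0.
by move=> /(semiposdefmx_ker symA psdA) uA; rewrite -(mulmxK unitA u) uA mul0mx.
Qed.

(** Factoring [invmx A = L L^T] turns the trace into the sum of the form of [C] over the columns of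
    [L]. If this sum were not positive, every column would lie in the kernel of [C], so [L^T C = 0]
    and [C = 0]. *)
Lemma mxtrace_posdef_semiposdef_gt0 (R : realType) n (A C : 'M[R]_n) :
  A^T = A -> posdefmx A -> C^T = C -> semiposdefmx C -> C != 0 ->
  0 < \tr (invmx A *m C).
Proof.
move=> symA posA symC psdC; have unitA := posdefmx_unit symA posA.
have [L [trL defI posL]] : exists L : 'M[R]_n,
    [/\ is_trig_mx L, invmx A = L *m L^T & forall i, 0 < L i i].
  apply: cholesky; first by rewrite trmx_inv symA.
  move=> u u0; have := posA (u *m invmx A).
  rewrite trmx_mul trmx_inv symA !mulmxA mulmxKV //; apply.
  by apply: contra u0 => /eqP uA; rewrite -(mulmxKV unitA u) uA mul0mx.
have unitL := trig_posdiag_unit trL posL.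
have trE : \tr (invmx A *m C) = \sum_k (row k L^T *m C *m (row k L^T)^T) 0 0.
  rewrite defI -mulmxA mxtrace_mulC; apply: eq_bigr => k _.
  rewrite -row_mul !mxE; apply: eq_bigr => j _.
  by rewrite !mxE.
rewrite trE; apply: contraNT; rewrite -leNgt => le0.
have LC0 : L^T *m C = 0.
  apply/row_matrixP => k; rewrite row_mul row0.
  apply: semiposdefmx_ker => //; move: le0; apply: le_trans.
  by rewrite (bigD1 k) //= lerDl sumr_ge0 // => i _; exact: psdC.
by rewrite -[C](mulKmx (_ : L^T \in unitmx)) ?unitmx_tr // LC0 mulmx0.
Qed.

(** * Tangent lines and continuity for powers of the absolute value *)

Lemma powR_bernoulli_lt (R : realType) (q y : R) :
  1 < q -> 0 <= y -> y != 1 -> 1 + q * (y - 1) < y `^ q.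
Proof.
move=> q1; have q0 : 0 < q by lra.
rewrite le_eqVlt => /predU1P[<- _|y0 y1].
  by rewrite powR0 ?gt_eqF //; lra.
have [w_le0|w_gt0] := leP (1 + q * (y - 1)) 0.
  exact: le_lt_trans w_le0 (powR_gt0 _ y0).
set w := 1 + _ in w_gt0 *.
rewrite -ltr_ln ?posrE ?powR_gt0 // ln_powR.
(* The tangent to [ln] at [y], evaluated at [w], gives [ln w <= ln y - (q - 1) (1 - y) / y].
   Evaluated at 1, where it is strict because [y != 1], it bounds the last term strictly by
   [(q - 1) ln y]. *)
have ln_tangent z : 0 < z -> ln z <= ln y + (z - y) / y.
  move=> z0; rewrite -[z in ln z](mulfVK (lt0r_neq0 y0)).
  rewrite lnM ?posrE ?divr_gt0 //.
  rewrite addrC lerD2l; have := @le_ln1Dx _ ((z - y) / y).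
  have -> : 1 + (z - y) / y = z / y by field; rewrite gt_eqF.
  apply; have -> : (z - y) / y = z / y - 1 by field; rewrite gt_eqF.
  by rewrite ltrBrDl subrr divr_gt0.
have ln1_tangent : 0 < ln y + (1 - y) / y.
  have ny0 : y^-1 - 1 != 0 by rewrite subr_eq0 invr_eq1.
  have := @expR_gt1Dx _ (- ln y).
  rewrite oppr_eq0 ln_eq0 // => /(_ y1).
  rewrite expRN lnK ?posrE // => h.
  have -> : (1 - y) / y = y^-1 - 1 by field; rewrite gt_eqF.
  lra.
have := ln_tangent _ w_gt0.
have wy : (w - y) / y = - ((q - 1) * ((1 - y) / y)).
  by rewrite /w; field; rewrite gt_eqF.
rewrite wy => h.
have : 0 < (q - 1) * (ln y + (1 - y) / y) by rewrite mulr_gt0 // subr_gt0.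
rewrite mulrDr; lra.
Qed.

(** For [x >= 0] this is the strict Bernoulli inequality at [x / s], scaled by [s ^ q]. For [x < 0],
    replacing [x] by its absolute value strictly raises the tangent line, whose slope is positive,
    and leaves the right-hand side unchanged. *)
Lemma normr_powR_tangent_lt (R : realType) (q s x : R) :
  1 < q -> 0 < s -> x != s ->
  s `^ q + q * s `^ (q - 1) * (x - s) < `|x| `^ q.
Proof.
move=> q1 s0 xs; have q0 : 0 < q by lra.
have sq0 : 0 < s `^ (q - 1) by rewrite powR_gt0.
have qE : s `^ q = s * s `^ (q - 1) by rewrite mulr_powRB1 ?ltW.
have xE : `|x| `^ q = (`|x| / s) `^ q * (s * s `^ (q - 1)).
  by rewrite -qE -powRM ?mulfVK ?gt_eqF ?divr_ge0 // ltW.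
have E z : s `^ q + q * s `^ (q - 1) * (z - s) =
    (1 + q * (z / s - 1)) * (s * s `^ (q - 1)).
  by rewrite qE; field; rewrite gt_eqF.
have [x_ge0|x_lt0] := leP 0 x.
  rewrite xE E ltr_pM2r ?mulr_gt0 // ger0_norm //.
  apply: powR_bernoulli_lt => //; first by rewrite divr_ge0 // ltW.
  apply: contra xs => /eqP xs1; apply/eqP.
  by rewrite -(mulfVK (lt0r_neq0 s0) x) xs1 mul1r.
apply: (@lt_le_trans _ _ (s `^ q + q * s `^ (q - 1) * (`|x| - s))).
  by rewrite ltrD2l ltr_pM2l ?mulr_gt0 // ltrD2r ltr0_norm //; lra.
rewrite xE E ler_pM2r ?mulr_gt0 //.
have [->|ne] := eqVneq (`|x| / s) 1; first by rewrite subrr mulr0 addr0 powR1.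
by apply/ltW/powR_bernoulli_lt => //; rewrite divr_ge0 // ltW.
Qed.

(** At 0 the function is squeezed by [|y|], since [q > 1] and [|y|] is eventually below 1; elsewhere
    the power is differentiable at [|x| > 0]. *)
Lemma normr_powR_continuous (R : realType) (q : R) :
  1 < q -> continuous (fun x : R => `|x| `^ q).
Proof.
move=> q1 x; have q0 : 0 < q by lra.
have [->|x0] := eqVneq x 0.
  rewrite /continuous_at normr0 powR0 ?gt_eqF //.
  apply/cvgr0Pnorm_lt => e e0.
  near=> y; have [->|y0] := eqVneq y 0.
    by rewrite normr0 powR0 ?normr0 ?gt_eqF.
  have y_lt : `|y| < Num.min 1 e.
    by near: y; apply: cvgr0_norm_lt; [exact: cvg_id|rewrite lt_min ltr01].
  move: y_lt; rewrite lt_min => /andP[y1]; apply: le_lt_trans.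
  rewrite ger0_norm ?powR_ge0 // ge1r_powR //; last exact: ltW.
  by rewrite normr_gt0 y0 ltW.
have nx0 : 0 < `|x| by rewrite normr_gt0.
apply: (@cvg_comp _ _ _ Num.norm (fun a => a `^ q) _ (nbhs `|x|)).
  exact: norm_continuous.
have /(@derivable_powR R 1 q)/derivable1_diffP : `|x| \in `]0, +oo[%R.
  by rewrite in_itv /= nx0.
by move/differentiable_continuous.
Unshelve. all: by end_near. Qed.

(** * First-order condition at a maximum of the determinant *)

Lemma continuous_det (T : topologicalType) (R : realType) n (F : T -> 'M[R]_n) :
  (forall i j, continuous (fun x => F x i j)) ->
  continuous (fun x => \det (F x)).
Proof.
move=> cF; rewrite /determinant.
apply: continuous_big => [|s _]; first exact: add_continuous.
move=> x; apply: cvgM; first exact: cvg_cst.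
move: x; apply: continuous_big => [|i _]; first exact: mul_continuous.
exact: cF.
Qed.

Lemma continuous_adj (T : topologicalType) (R : realType) n
    (F : T -> 'M[R]_n) i j :
  (forall i j, continuous (fun x => F x i j)) ->
  continuous (fun x => (\adj (F x)) i j).
Proof.
move=> cF; under [X in continuous X]eq_fun do rewrite mxE /cofactor.
move=> x; apply: cvgM; first exact: cvg_cst.
move: x; apply: continuous_det => k l.
under [X in continuous X]eq_fun do rewrite !mxE.
exact: cF.
Qed.

(** The determinant is never differentiated. For [C = (1 - x) A + x S], the tangent bound at [C]
    evaluated at [A], combined with [\det C <= \det A], forces [\tr (C^-1 A) >= n]. As
    [A = C - x (S - A)], this says [\tr (C^-1 (S - A)) <= 0]; then [x] tends to 0 from the right. *)
Lemma mxtrace_inv_le_of_det_max (R : realType) n (A S : 'M[R]_n) :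
  A^T = A -> posdefmx A -> S^T = S -> semiposdefmx S ->
  (forall x, 0 < x < 1 -> \det ((1 - x) *: A + x *: S) <= \det A) ->
  \tr (invmx A *m S) <= n%:R.
Proof.
move=> symA posA symS psdS maxA.
pose C x := (1 - x) *: A + x *: S.
(* The adjugate replaces the inverse, from which it differs by the factor [\det (C x) > 0] on
   [0 < x < 1]. Its entries are polynomial, so [f] is continuous everywhere. *)
pose f x := \tr (\adj (C x) *m (S - A)).
have symC x : (C x)^T = C x by rewrite /C linearD !linearZ /= symA symS.
have posC x : 0 < x < 1 -> posdefmx (C x).
  move=> /andP[x0 x1] u u0.
  rewrite /C mulmxDr mulmxDl -!scalemxAr -!scalemxAl !mxE.
  have := posA u u0; have := psdS u; rewrite !mxE => h1 h2.
  rewrite ltr_pwDl //; first by rewrite mulr_gt0 // subr_gt0.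
  by rewrite mulr_ge0 // ltW.
have adjE (M : 'M[R]_n) : M \in unitmx -> \adj M = \det M *: invmx M.
  move=> uM; rewrite /invmx uM scalerA mulfV ?scale1r //.
  by rewrite -unitfE -unitmxE.
have f_le0 x : 0 < x < 1 -> f x <= 0.
  move=> x01; have posCx := posC _ x01; have uC := posdefmx_unit (symC x) posCx.
  have dC := posdefmx_det_gt0 (symC x) posCx.
  rewrite /f adjE // -scalemxAl mxtraceZ pmulr_rle0 //.
  have /le_trans/(_ (ler_wpM2r (expR_ge0 _) (maxA x x01))) :=
    det_le_tangent (symC x) posCx symA posA.
  rewrite -[X in X <= _]mulr1 ler_pM2l ?posdefmx_det_gt0 //.
  rewrite -[X in X <= expR _]expR0 ler_expR subr_ge0.
  have /andP[x0 _] := x01.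
  have -> : \tr (invmx (C x) *m A) = n%:R - x * \tr (invmx (C x) *m (S - A)).
    rewrite -[in RHS](mxtrace1 R n) -(mulVmx uC).
    rewrite -mxtraceZ -linearB /= scalemxAr -mulmxBr.
    congr (\tr (_ *m _)); rewrite /C; apply/matrixP => i j; rewrite !mxE; ring.
  by rewrite lerDl oppr_ge0 pmulr_rle0.
have cf : continuous f.
  apply: continuous_big => [|i _]; first exact: add_continuous.
  under [X in continuous X]eq_fun do rewrite mxE.
  apply: continuous_big => [|j _]; first exact: add_continuous.
  move=> x; apply: cvgM; last exact: cvg_cst.
  move: x; apply: continuous_adj => k l.
  under [X in continuous X]eq_fun do rewrite !mxE.
  move=> x; apply: cvgD; apply: cvgM; try exact: cvg_cst; last exact: cvg_id.
  by apply: cvgB; [exact: cvg_cst|exact: cvg_id].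
have f0 : f 0 <= 0.
  rewrite leNgt; apply/negP => f0_gt0.
  have : \forall x \near 0^'+, 0 < f x.
    apply: cvgr_gt f0_gt0; apply: cvg_at_right_filter; exact: cf.
  move=> h; near (0:R)^'+ => x.
  have : f x <= 0.
    apply: f_le0; apply/andP; split; near: x.
      exact: nbhs_right_gt.
    exact: nbhs_right_lt.
  by rewrite leNgt => /negP; apply; near: x.
move: f0; rewrite /f /C subr0 scale1r scale0r addr0 adjE ?posdefmx_unit //.
rewrite -scalemxAl mxtraceZ pmulr_rle0 ?posdefmx_det_gt0 //.
by rewrite mulmxBr mulVmx ?posdefmx_unit // linearB /= mxtrace1 subr_le0.
Unshelve. all: by end_near. Qed.

(** * Linear combinations of the given matrices *)

Lemma lincombmx_tr (R : realType) m n (B : 'I_m -> 'M[R]_n) (t : 'rV[R]_m) :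
  (forall i, (B i)^T = B i) -> (lincombmx B t)^T = lincombmx B t.
Proof.
move=> symB; rewrite /lincombmx linear_sum; apply: eq_bigr => i _.
by rewrite linearZ /= symB.
Qed.

Lemma qform_lincombmx (R : realType) m n (B : 'I_m -> 'M[R]_n)
    (t : 'rV[R]_m) (u : 'rV[R]_n) :
  (u *m lincombmx B t *m u^T) 0 0 = \sum_i t 0 i * (u *m B i *m u^T) 0 0.
Proof.
rewrite /lincombmx mulmx_sumr mulmx_suml summxE; apply: eq_bigr => i _.
by rewrite -scalemxAr -scalemxAl mxE.
Qed.

Lemma lincombmx_psd (R : realType) m n (B : 'I_m -> 'M[R]_n) (t : 'rV[R]_m) :
  (forall i, semiposdefmx (B i)) -> (forall i, 0 <= t 0 i) ->
  semiposdefmx (lincombmx B t).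
Proof.
move=> psdB t_ge0 u; rewrite qform_lincombmx sumr_ge0 // => i _.
by rewrite mulr_ge0 // psdB.
Qed.

(** The plain sum is semidefinite and invertible, hence definite. If the form of [lincombmx B t]
    vanished at [u], positivity of [t] would make the form of every [B i] vanish at [u], and so that
    of the sum. *)
Lemma lincombmx_posdef (R : realType) m n (B : 'I_m -> 'M[R]_n) (t : 'rV[R]_m) :
  (forall i, (B i)^T = B i) -> (forall i, semiposdefmx (B i)) ->
  \rank (\sum_i B i)%R = n -> positive_row t -> posdefmx (lincombmx B t).
Proof.
move=> symB psdB rkB t_gt0 u u0.
have sumE : \sum_i B i = lincombmx B (const_mx 1).
  by apply: eq_bigr => i _; rewrite mxE scale1r.
have pos1 : posdefmx (\sum_i B i).
  apply: semiposdefmx_unit_posdef.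
  - by rewrite sumE lincombmx_tr.
  - by rewrite sumE; apply: lincombmx_psd => // i; rewrite mxE.
  - by rewrite -row_full_unit /row_full rkB.
rewrite lt_neqAle lincombmx_psd ?andbT // => [|i]; last exact: ltW.
apply/eqP => q0; have := pos1 u u0; rewrite sumE qform_lincombmx.
rewrite big1 ?ltxx // => i _; rewrite mxE mul1r.
move/esym/eqP: q0; rewrite qform_lincombmx psumr_eq0 => [|j _]; last first.
  by rewrite mulr_ge0 ?psdB // ltW.
move=> /allP/(_ i); rewrite mem_index_enum => /(_ isT).
by rewrite mulf_eq0 gt_eqF //= => /eqP.
Qed.

Lemma mxtrace_lincombmx (R : realType) m n (B : 'I_m -> 'M[R]_n)
    (t : 'rV[R]_m) (M : 'M[R]_n) :
  \tr (M *m lincombmx B t) = \sum_i t 0 i * \tr (M *m B i).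
Proof.
rewrite /lincombmx mulmx_sumr raddf_sum; apply: eq_bigr => i _.
by rewrite -scalemxAr /= mxtraceZ.
Qed.

(** * The norm term, and stationary vectors as strict minimizers of the potential *)

Lemma row_pnorm_powR (R : realType) m (q : R) (t : 'rV[R]_m) :
  q != 0 -> row_pnorm q t `^ q = \sum_i `|t 0 i| `^ q.
Proof.
by move=> q0; rewrite /row_pnorm -powRrM mulVf // powRr1 // sumr_ge0.
Qed.

Lemma normr_powR_tangent (R : realType) (q s x : R) :
  1 < q -> 0 < s ->
  s `^ q + q * s `^ (q - 1) * (x - s) <= `|x| `^ q ?= iff (x == s).
Proof.
move=> q1 s0; have [->|ne] := eqVneq x s.
  by rewrite gtr0_norm // subrr mulr0 addr0; exact: leif_refl.
by have lt := normr_powR_tangent_lt q1 s0 ne; split; rewrite ?ltW ?lt_eqF.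
Qed.

(** The equality case serves twice: it makes the minimum of the potential strict, and it identifies
    the maximizer [t] with the explicit vector [s] in the existence proof. *)
Lemma sum_powR_tangent (R : realType) m (q : R) (t s : 'rV[R]_m) :
  1 < q -> positive_row t ->
  \sum_i (t 0 i `^ q + q * t 0 i `^ (q - 1) * (s 0 i - t 0 i))
    <= \sum_i `|s 0 i| `^ q ?= iff (s == t).
Proof.
move=> q1 t0; have -> : (s == t) = [forall i, s 0 i == t 0 i].
  apply/eqP/forallP => [-> //|eqst].
  by apply/rowP => i; apply/eqP.
by apply: leif_sum => i _; exact: normr_powR_tangent.
Qed.

(* Vanishing of the gradient of [potential q B] on positive vectors. *)
Definition stationary (R : realType) m n (q : R) (B : 'I_m -> 'M[R]_n)
    (t : 'rV[R]_m) : Prop :=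
  positive_row t /\
  forall i, \tr (invmx (lincombmx B t) *m B i) = n%:R * t 0 i `^ (q - 1).

(** The leverage is [t_i g_i] with [g_i] the trace, so raising the equation to the power [q] gives
    [t_i g_i = n t_i ^ q], and [t_i > 0] cancels. The trace is positive, so taking the root and then
    the power returns [t_i g_i]. *)
Lemma leverage_stationary (R : realType) m n (q : R)
    (B : 'I_m -> 'M[R]_n) (t : 'rV[R]_m) :
  1 < q -> (forall i, (B i)^T = B i) -> (forall i, semiposdefmx (B i)) ->
  (forall i, B i != 0) -> \rank (\sum_i B i)%R = n ->
  (positive_row t /\
    forall i, leverage B t i `^ q^-1 / t 0 i = n%:R `^ q^-1) <->
  stationary q B t.
Proof.
move=> q1 symB psdB B0 rkB; have q0 : q != 0 by rewrite gt_eqF //; lra.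
have levE i : leverage B t i = t 0 i * \tr (invmx (lincombmx B t) *m B i).
  by rewrite /leverage mxtraceZ.
split=> -[t0 eqt]; split=> // i; have ti0 := t0 i.
  have : 0 < \tr (invmx (lincombmx B t) *m B i).
    apply: mxtrace_posdef_semiposdef_gt0 => //; first exact: lincombmx_tr.
    exact: lincombmx_posdef.
  move: (eqt i); rewrite levE; set g := \tr _ => E g0.
  have {}E : (t 0 i * g) `^ q^-1 = n%:R `^ q^-1 * t 0 i.
    by rewrite -E mulfVK // gt_eqF.
  move/(congr1 (fun x => x `^ q)): E => /=.
  rewrite [RHS]powRM ?powR_ge0 ?(ltW ti0) // -!powRrM mulVf //.
  rewrite !powRr1 ?ler0n //; last first.
    by rewrite mulr_ge0 ?ltW.
  rewrite -(mulr_powRB1 (ltW ti0)); last by lra.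
  by rewrite mulrCA; apply: mulfI; rewrite gt_eqF.
rewrite levE eqt mulrCA mulr_powRB1 ?ltW //; last by lra.
rewrite powRM ?ler0n ?powR_ge0 // -powRrM mulfV // powRr1 ?mulfK ?gt_eqF //.
exact: ltW.
Qed.

Lemma stationary_sum_powR (R : realType) m n (q : R)
    (B : 'I_m -> 'M[R]_n) (t : 'rV[R]_m) :
  (0 < n)%N -> 1 < q -> lincombmx B t \in unitmx -> stationary q B t ->
  \sum_i `|t 0 i| `^ q = 1.
Proof.
move=> n0 q1 unitB [t0 eqt].
have n0' : (n%:R : R) != 0 by rewrite pnatr_eq0 -lt0n.
apply: (mulfI n0'); rewrite mulr1 mulr_sumr.
rewrite -[RHS](mxtrace1 R n) -(mulVmx unitB) mxtrace_lincombmx.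
apply: eq_bigr => i _; rewrite eqt mulrCA mulr_powRB1 ?ltW //; last by lra.
by rewrite gtr0_norm.
Qed.

(** Two tangent bounds at [t] are added: one for [ln \det], one, strict, for the power sum.
    Stationarity makes their linear terms in [s - t] cancel. *)
Lemma stationary_strict_min (R : realType) m n (q : R) (B : 'I_m -> 'M[R]_n)
    (t s : 'rV[R]_m) :
  (0 < n)%N -> 1 < q -> (forall i, (B i)^T = B i) ->
  posdefmx (lincombmx B t) -> stationary q B t -> s != t ->
  (potential q B t < potential q B s)%E.
Proof.
move=> n0 q1 symB posBt [t0 eqt] st; rewrite /potential.
have q0 : 0 < q by lra.
case: asboolP => // _; case: asboolP => [posBs|_]; last exact: ltry.
rewrite lte_fin !row_pnorm_powR ?gt_eqF //.
have symt := lincombmx_tr t symB; have syms := lincombmx_tr s symB.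
have dt := posdefmx_det_gt0 symt posBt; have ds := posdefmx_det_gt0 syms posBs.
have := det_le_tangent symt posBt syms posBs.
rewrite -ler_ln ?posrE ?mulr_gt0 ?expR_gt0 // lnM ?posrE ?expR_gt0 // expRK.
have -> : \tr (invmx (lincombmx B t) *m lincombmx B s) - n%:R =
    \sum_i n%:R * t 0 i `^ (q - 1) * (s 0 i - t 0 i).
  rewrite -{1}(mxtrace1 R n) -(mulVmx (posdefmx_unit symt posBt)).
  rewrite !mxtrace_lincombmx -sumrB; apply: eq_bigr => i _.
  by rewrite eqt -mulrBl mulrC.
move=> dle.
have : \sum_j (t 0 j `^ q + q * t 0 j `^ (q - 1) * (s 0 j - t 0 j))
    < \sum_j `|s 0 j| `^ q by rewrite (lt_leif (sum_powR_tangent s q1 t0)).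
have -> : \sum_j `|t 0 j| `^ q = \sum_j t 0 j `^ q.
  by apply: eq_bigr => i _; rewrite gtr0_norm.
rewrite big_split /=.
set S1 := \sum_j t 0 j `^ q; set S2 := \sum_j `|s 0 j| `^ q.
set S3 := \sum_j _ => lt12.
have nq0 : 0 < n%:R / q :> R by rewrite divr_gt0 // ltr0n.
have S3E : \sum_j n%:R * t 0 j `^ (q - 1) * (s 0 j - t 0 j) = n%:R / q * S3.
  by rewrite /S3 mulr_sumr; apply: eq_bigr => j _; field; rewrite gt_eqF.
rewrite S3E in dle.
have : n%:R / q * (S1 + S3) < n%:R / q * S2 by rewrite ltr_pM2l.
by rewrite mulrDr; move: dle; lra.
Qed.

(** * Existence of a stationary vector by compactness *)

Definition nonneg_ball (R : realType) m (q : R) : set 'rV[R]_m :=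
  [set t | (forall i, 0 <= t 0 i) /\ \sum_i `|t 0 i| `^ q <= 1].

(** A coordinate above 1 would alone push the power sum above 1, so the set is a closed part of the
    cube of side [[0, 1]]. *)
Lemma nonneg_ball_compact (R : realType) m (q : R) :
  1 < q -> compact (@nonneg_ball R m q).
Proof.
move=> q1; have -> : @nonneg_ball R m q =
    [set t : 'rV[R]_m | forall i, `[0, 1] (t ord0 i)] `&`
    [set t | \sum_i `|t 0 i| `^ q <= 1].
  apply/seteqP; split=> t /= [t0 sum1]; split=> // i; last first.
    by have := t0 i; rewrite in_itv /= => /andP[].
  rewrite in_itv /= t0 /= leNgt; apply/negP => t1.
  move: sum1; rewrite leNgt => /negP; apply.
  apply: (@lt_le_trans _ _ (`|t 0 i| `^ q)).
    by rewrite ger0_norm //; apply: (lt_le_trans t1);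
      apply: le1r_powR; exact: ltW.
  by rewrite (bigD1 i) //= lerDl sumr_ge0.
apply: compact_closedI.
  by apply: (@rV_compact R m (fun=> `[0, 1])) => i; exact: segment_compact.
suff /continuous_closedP/(_ _ (@closed_le R 1)) :
  continuous (fun t : 'rV[R]_m => \sum_i `|t 0 i| `^ q) by [].
apply: continuous_big => [|i _]; first exact: add_continuous.
move=> t; apply: (@cvg_comp _ _ _ (fun t : 'rV[R]_m => t 0 i)
  (fun x => `|x| `^ q) _ (nbhs (t 0 i))).
  exact: coord_continuous.
exact: normr_powR_continuous.
Qed.

Lemma nonneg_ball_convex (R : realType) m (q x : R) (t s : 'rV[R]_m) :
  1 < q -> 0 <= x <= 1 -> nonneg_ball q t -> nonneg_ball q s ->
  nonneg_ball q ((1 - x) *: t + x *: s).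
Proof.
move=> q1 /andP[x0 x1] [t0 t1] [s0 s1].
have x'0 : 0 <= 1 - x by rewrite subr_ge0.
have ge0 i : 0 <= ((1 - x) *: t + x *: s) 0 i.
  by rewrite !mxE addr_ge0 ?mulr_ge0.
split=> //.
apply: (@le_trans _ _ (\sum_i ((1 - x) * `|t 0 i| `^ q + x * `|s 0 i| `^ q))).
  apply: ler_sum => i _; rewrite ger0_norm // !mxE !ger0_norm //.
  have := @convex_powR R q (ltW q1) (Itv01 x0 x1) (s 0 i) (t 0 i).
  rewrite !inE /= !in_itv /= !andbT !s0 !t0 => /(_ isT isT).
  by rewrite ![(1 - x) * _ + _]addrC.
rewrite big_split /= -!mulr_sumr.
have := ler_wpM2l x'0 t1; have := ler_wpM2l x0 s1; lra.
Qed.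

Lemma det_max_nonneg_ball (R : realType) m n (q : R) (B : 'I_m -> 'M[R]_n) :
  (0 < m)%N -> 1 < q ->
  (forall i, (B i)^T = B i) -> (forall i, semiposdefmx (B i)) ->
  \rank (\sum_i B i)%R = n ->
  exists t : 'rV[R]_m, [/\ nonneg_ball q t, posdefmx (lincombmx B t) &
    forall s, nonneg_ball q s -> \det (lincombmx B s) <= \det (lincombmx B t)].
Proof.
move=> m0 q1 symB psdB rkB; have q0 : 0 < q by lra.
have mR0 : 0 < m%:R :> R by rewrite ltr0n.
(* The constant vector with power sum exactly 1. Being positive it has [\det (lincombmx B c) > 0],
   so the maximal determinant is positive and the semidefinite matrix at the maximizer is
   invertible, hence definite. *)
pose c : 'rV[R]_m := const_mx (m%:R `^ (- q^-1)).
have c0 : positive_row c by move=> i; rewrite mxE powR_gt0.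
have cball : nonneg_ball q c.
  split=> [i|]; first exact: ltW.
  under eq_bigr => i _ do rewrite mxE ger0_norm ?powR_ge0 // -powRrM mulNr
    mulVf ?gt_eqF // powR_inv1 ?ler0n //.
  by rewrite sumr_const card_ord -[_^-1 *+ _]mulr_natl mulfV ?gt_eqF.
have cdet : continuous (fun t : 'rV[R]_m => \det (lincombmx B t)).
  apply: continuous_det => i j.
  under [X in continuous X]eq_fun do rewrite summxE.
  apply: continuous_big => [|k _]; first exact: add_continuous.
  under [X in continuous X]eq_fun do rewrite mxE.
  move=> t; exact: (cvgM (@coord_continuous R 1 m 0 k t) (cvg_cst _)).
have [|t] := EVT_max_rV _ (@nonneg_ball_compact R m q q1)
  (continuous_subspaceT cdet).
  by exists c.
rewrite inE => -[t0 t1] maxt; exists t; split=> //; last first.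
  by move=> s sball; apply: maxt; rewrite inE.
apply: semiposdefmx_unit_posdef.
- exact: lincombmx_tr.
- exact: lincombmx_psd.
- rewrite unitmxE unitfE gt_eqF //.
  apply: lt_le_trans (maxt c _); last by rewrite inE.
  by apply: posdefmx_det_gt0; [exact: lincombmx_tr|exact: lincombmx_posdef].
Qed.

Lemma stationary_exists (R : realType) m n (q : R) (B : 'I_m -> 'M[R]_n) :
  (0 < m)%N -> 1 < q ->
  (forall i, (B i)^T = B i) -> (forall i, semiposdefmx (B i)) ->
  (forall i, B i != 0) -> \rank (\sum_i B i)%R = n ->
  exists t, stationary q B t.
Proof.
move=> m0 q1 symB psdB B0 rkB.
have [t [tball post maxt]] := det_max_nonneg_ball m0 q1 symB psdB rkB.
have q0 : 0 < q by lra.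
have q'0 : 0 < q - 1 by lra.
have symt := lincombmx_tr t symB.
pose g i := \tr (invmx (lincombmx B t) *m B i).
have g0 i : 0 < g i by exact: mxtrace_posdef_semiposdef_gt0.
(* Equality case of the Hölder inequality: normalizing [w] to power sum 1 yields the vector [s]
   maximizing the linear form [g], and [g] becomes a multiple [l] of [s ^ (q - 1)]. *)
pose w i := g i `^ (q - 1)^-1.
have w0 i : 0 < w i by exact: powR_gt0.
have wE i : w i `^ (q - 1) = g i.
  by rewrite /w -powRrM mulVf ?gt_eqF // powRr1 // ltW.
pose W := (\sum_i w i `^ q) `^ q^-1.
have Wq : W `^ q = \sum_i w i `^ q.
  rewrite /W -powRrM mulVf ?gt_eqF // powRr1 // sumr_ge0 // => i _.
  exact: powR_ge0.
have W0 : 0 < W.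
  rewrite powR_gt0 // (bigD1 (Ordinal m0)) //= ltr_wpDr //.
    by rewrite sumr_ge0 // => i _; exact: powR_ge0.
  exact: powR_gt0.
pose s : 'rV[R]_m := \row_i (w i / W).
have s0 : positive_row s by move=> i; rewrite mxE divr_gt0.
have sE r i : s 0 i `^ r = w i `^ r / W `^ r.
  by rewrite mxE powRM ?invr_ge0 ?ltW // -powR_inv1 ?(ltW W0) //
    powRAC powR_inv1 ?powR_ge0.
have sum_s : \sum_i s 0 i `^ q = 1.
  under eq_bigr do rewrite sE.
  by rewrite -mulr_suml -Wq mulfV // gt_eqF // powR_gt0.
have sball : nonneg_ball q s.
  split=> [i|]; first exact: ltW.
  by under eq_bigr => i _ do rewrite gtr0_norm //; rewrite sum_s.
pose l := W `^ (q - 1).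
have l0 : 0 < l by exact: powR_gt0.
have gE i : g i = l * s 0 i `^ (q - 1).
  by rewrite sE wE /l mulrC mulfVK // gt_eqF.
have gt : \sum_i t 0 i * g i = n%:R.
  by rewrite -mxtrace_lincombmx mulVmx ?mxtrace1 // posdefmx_unit.
have gs : \sum_i s 0 i * g i <= n%:R.
  rewrite -mxtrace_lincombmx; apply: mxtrace_inv_le_of_det_max => //.
  - exact: lincombmx_tr.
  - by apply: lincombmx_psd => // i; exact: ltW.
  move=> x /andP[/ltW x0 /ltW x1].
  have -> : (1 - x) *: lincombmx B t + x *: lincombmx B s =
      lincombmx B ((1 - x) *: t + x *: s).
    rewrite /lincombmx !scaler_sumr -big_split /=; apply: eq_bigr => i _.
    by rewrite !scalerA -scalerDl; congr (_ *: _); rewrite !mxE.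
  by apply: maxt; apply: nonneg_ball_convex => //; rewrite x0.
have [le_t eq_t] := sum_powR_tangent t q1 s0.
have tsum : \sum_i `|t 0 i| `^ q <= 1 by case: tball.
(* The tangent to the power sum at [s], evaluated at [t]. By [gs] its value is at least 1, while the
   power sum of [t] is at most 1; equality is forced, so [t = s]. *)
have gap : \sum_i (s 0 i `^ q + q * s 0 i `^ (q - 1) * (t 0 i - s 0 i)) =
    1 + q / l * (n%:R - \sum_i s 0 i * g i).
  rewrite big_split /= sum_s -gt -sumrB mulr_sumr; congr (1 + _).
  by apply: eq_bigr => i _; rewrite gE; field; rewrite gt_eqF.
have gap_ge0 : 0 <= q / l * (n%:R - \sum_i s 0 i * g i).
  by rewrite mulr_ge0 ?divr_ge0 ?subr_ge0 // ltW.
have ts : t = s.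
  apply/eqP; rewrite -eq_t eq_le le_t /=; apply: (le_trans tsum).
  by rewrite gap lerDl.
exists t; split; first by rewrite ts.
(* Pairing [g = l s ^ (q - 1)] with [t = s] gives [n] on one side and [l] times the power sum 1 on
   the other. *)
have ln : l = n%:R.
  rewrite -gt -[l]mulr1 -sum_s mulr_sumr; apply: eq_bigr => i _.
  by rewrite gE ts mulrCA mulr_powRB1 // ltW.
by move=> i; rewrite -/(g i) gE ln ts.
Qed.

Theorem proposition5p5 (R : realType) (p q : R) (m n r : nat)
    (B : 'I_m -> 'M[R]_n)
    (p_gt1 : 1 < p) (conj_pq : p^-1 + q^-1 = 1)
    (le_nm : (n <= m)%N) (r_bounds : (1 <= r <= n)%N)
    (B_sym : forall i, B i \is symmetricmx)
    (B_neq0 : forall i, B i != 0)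
    (B_psd : forall i, semiposdefmx (B i))
    (B_rank : forall i, (\rank (B i) <= r)%N)
    (sumB_rank : \rank (\sum_(i < m) B i)%R = n) :
  exists tau : 'rV[R]_m,
    [/\ unique (fun t : 'rV[R]_m => positive_row t /\
          forall i, leverage B t i `^ q^-1 / t 0 i = n%:R `^ q^-1) tau,
        row_pnorm q tau = 1
      & unique (minimizer (potential q B)) tau].
Proof.
have n0 : (0 < n)%N by case/andP: r_bounds; exact: leq_trans.
have m0 : (0 < m)%N by exact: leq_trans le_nm.
have symB i : (B i)^T = B i by exact: symmetricmx_tr.
have q1 : 1 < q.
  have p0 : 0 < p by lra.
  have p1 : 0 < p^-1 < 1 by rewrite invr_gt0 p0 invf_lt1.
  have qi : 0 < q^-1 < 1 by lra.
  by case/andP: qi => qi0; rewrite invf_lt1 // -invr_gt0.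
have statE t := leverage_stationary t q1 symB B_psd B_neq0 sumB_rank.
have [t statt] := stationary_exists m0 q1 symB B_psd B_neq0 sumB_rank.
have posB s : positive_row s -> posdefmx (lincombmx B s).
  exact: lincombmx_posdef.
have strict u s : stationary q B u -> s != u ->
    (potential q B u < potential q B s)%E.
  move=> statu; apply: stationary_strict_min => //.
  by apply: posB; case: statu.
exists t; split.
- split=> [|s /statE stats]; first exact/statE.
  (* Two distinct stationary vectors would each have a strictly smaller potential than the other. *)
  apply/eqP/negP => /negP ts.
  have := strict _ _ stats ts; rewrite ltNge => /negP; apply.
  by apply/ltW/strict => //; rewrite eq_sym.
- rewrite /row_pnorm (stationary_sum_powR n0 q1 _ statt) ?powR1 //.
  by apply: posdefmx_unit; [exact: lincombmx_tr|apply: posB; case: statt].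
- split=> [s|s mins].
    by have [->//|st] := eqVneq s t; apply/ltW/strict.
  apply/eqP/negP => /negP; rewrite eq_sym => st.
  by have := mins t; rewrite leNgt strict.
Qed.
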